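(* Let $p$ be a prime and let $P\in\mathbb{R}[X,Y]$ be a $\mathcal{T}$-elliptic polynomial of degree $d\ge 1$. Assume moreover that $P(x,y)\ge 0$ for every $(x,y)\in\mathbb{R}^2$ with $x\ge y\ge 0$. Then $N_p(P;u)\asymp u^{\theta_p/d}$ as $u\to\infty$ ($u$ ranging over positive integers).
   Context: Let $\mathbb{N}_0$ be the set of non-negative integers. For a prime $p$, let $\mathrm{Pas}(p)=\{(m,n)\in\mathbb{N}_0\times\mathbb{N}_0 : m\ge n,\ \binom{m}{n}\not\equiv 0 \pmod p\}$ and $\theta_p=\log\frac{p(p+1)}{2}/\log p$. A non-constant polynomial $P\in\mathbb{R}[X,Y]$ of degree $d$, with homogeneous part of degree $d$ denoted $P_d$, is called $\mathcal{T}$-elliptic if $P_d(x,y)>0$ for every $(x,y)\in\mathbb{R}^2\setminus\{(0,0)\}$ with $x\ge y\ge 0$. For a positive integer $u$, $N_p(P;u)=\#\{(m,n)\in\mathrm{Pas}(p) : P(m,n)<u\}$. The notation $f(u)\asymp g(u)$ as $u\to\infty$ means that there exist positive constants $C,C'$ such that $|f(u)|\le C g(u)$ and $|g(u)|\le C' f(u)$ for all sufficiently large $u$. *)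

(* Defs.v *)
From mathcomp Require Import all_boot all_order all_algebra finmap.
(* In the other order the notations of [mpoly] and of MathComp-Analysis clash. *)
From mathcomp Require Import mpoly.
From mathcomp Require Import all_classical all_reals all_analysis.

Set Implicit Arguments.
Unset Strict Implicit.
Unset Printing Implicit Defensive.

Import Order.TTheory GRing.Theory Num.Theory.
Import numFieldNormedType.Exports.

Local Open Scope classical_set_scope.
Local Open Scope ring_scope.

Definition eval2 (R : realType) (P : {mpoly R[2]}) (x y : R) : R :=
  P.@[tnth [tuple x; y]].

(* Total degree, with the convention that the zero polynomial has degree 0. *)
Definition total_degree (R : realType) (P : {mpoly R[2]}) : nat :=
  (msize P).-1.

Definition homog_part (R : realType) (k : nat) (P : {mpoly R[2]}) : {mpoly R[2]} :=
  pihomog mdeg k P.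

Definition T_elliptic (R : realType) (P : {mpoly R[2]}) : Prop :=
  (0 < total_degree P)%N /\
  forall x y : R, (x, y) <> (0, 0) -> 0 <= y -> y <= x ->
    0 < eval2 (homog_part (total_degree P) P) x y.

Definition Pas (p : nat) : set (nat * nat) :=
  [set mn | (mn.2 <= mn.1)%N /\ 'C(mn.1, mn.2) <> 0 %[mod p]].

Definition theta (R : realType) (p : nat) : R :=
  ln (p%:R * (p%:R + 1) / 2%:R) / ln p%:R.

(* [fset_set] sends an infinite set to the empty one, so an infinite count
   would read as 0; it is finite for all u when P is T-elliptic. *)
Definition N_Pas (R : realType) (p : nat) (P : {mpoly R[2]}) (u : nat) : nat :=
  #|` fset_set [set mn : nat * nat |
      Pas p mn /\ eval2 P mn.1%:R mn.2%:R < u%:R] |%fset.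

Definition asymp (R : realType) (f g : nat -> R) : Prop :=
  exists C C' : R, [/\ 0 < C, 0 < C' &
    \forall u \near \oo, `|f u| <= C * g u /\ `|g u| <= C' * f u].

(* Main.v *)
(* The digits of Lucas' theorem show that the part of Pas(p) in the box
   [0, p^k)^2 has exactly (p(p+1)/2)^k = (p^k)^theta elements. Ellipticity,
   through the minimum of P_d(1, t) on [0, 1], gives c x^d <= P(x, y) <= K x^d
   for large x in the cone, so {P < u} is squeezed between two such boxes whose
   sides p^k are within bounded factors of u^(1/d). *)
Require Import Defs.
From mathcomp Require Import all_boot all_order all_algebra finmap.
From mathcomp Require Import mpoly.
From mathcomp Require Import all_classical all_reals all_analysis.
From mathcomp Require Import zify lra ring.
Import Order.TTheory GRing.Theory Num.Theory numFieldNormedType.Exports.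

(** * Lucas' theorem, splitting off the lowest base-p digit *)

Lemma bin_lucas (p : nat) (p_prime : prime p) (a b c d : nat) :
  b < p -> d < p ->
  'C(a * p + b, c * p + d) = 'C(a, c) * 'C(b, d) %[mod p].
Proof.
have p_gt0 := prime_gt0 p_prime.
have pascal m k x y z w : 'C(m, k) = x * y %[mod p] ->
    'C(m, k.+1) = z * w %[mod p] ->
    'C(m.+1, k.+1) = z * w + x * y %[mod p].
  by move=> Hk Hk1; rewrite binS -modnDm Hk Hk1 modnDm.
(* In a column divisible by p, Pascal's rule reaches back to digit p - 1 of the previous block of
   columns; that term vanishes unless b' = p - 1. *)
have digitS a' b' c' : b' < p ->
    (forall c d, d < p ->
      'C(a' * p + b', c * p + d) = 'C(a', c) * 'C(b', d) %[mod p]) ->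
    'C((a' * p + b').+1, c'.+1 * p) = 'C(a', c'.+1) + 'C(a', c') * 'C(b', p.-1)
      %[mod p].
  move=> ltb' IH; have -> : c'.+1 * p = (c' * p + p.-1).+1 by nia.
  rewrite (pascal _ _ _ _ 'C(a', c'.+1) 1 (IH c' p.-1 _)); [by rewrite muln1 | lia |].
  by rewrite -(bin0 b') -IH //; congr ('C(_, _) %% _); nia.
elim: a b c d => [|a IHa].
  by move=> b c d ltbp ltdp; case: c => [|c];
    rewrite ?bin0 ?bin0n ?mul0n ?mul1n ?add0n // bin_small // mulSn; lia.
(* The last row of block a, from which Pascal's rule produces the first row of block a + 1. *)
have IHap c d : d < p ->
    'C(a * p + p.-1, c * p + d) = 'C(a, c) * 'C(p.-1, d) %[mod p].
  by apply: IHa; lia.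
have eqS : a.+1 * p = (a * p + p.-1).+1 by nia.
elim=> [|b IHb] c d ltbp ltdp.
  case: d ltdp => [|d] ltdp; last first.
    have := IHap c _ ltdp; rewrite addn0 eqS !addnS => /(pascal _ _ _ _ _ _ (IHap _ _ (ltnW ltdp))) ->.
    (* The two terms combine to a multiple of C(p, d + 1), which p divides since 0 < d + 1 < p. *)
    rewrite -mulnDr -binS prednK // bin0n muln0 mod0n.
    by apply/eqP; apply: dvdn_mull; apply: prime_dvd_bin => //; lia.
  rewrite !addn0; case: c => [|c]; first by rewrite !bin0.
  by rewrite eqS digitS ?prednK // !binn !muln1 binS.
have ltb : b < p by lia.
rewrite addnS; case: d ltdp => [|d] ltdp; last first.
  have := IHb c _ ltb ltdp; rewrite !addnS => /(pascal _ _ _ _ _ _ (IHb _ _ ltb (ltnW ltdp))) ->.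
  by rewrite -mulnDr -binS.
rewrite addn0; case: c => [|c]; first by rewrite !bin0.
rewrite digitS //; last by move=> c' d' ltd'; apply: IHb.
(* Here b < p - 1, so the term from the previous block of columns is 0. *)
by rewrite (@bin_small b) ?muln0 ?addn0 ?bin0 ?muln1 //; lia.
Qed.

(** For d <= b the binomial divides b!, a product of factors below p; for b < d it is 0. *)
Lemma dvdn_bin_digit (p b d : nat) : prime p -> b < p ->
  (p %| 'C(b, d)) = (b < d).
Proof.
move=> p_prime ltbp; case: ltnP => [ltbd | ledb]; first by rewrite bin_small ?dvdn0.
apply/negP => dvd_p; have : p %| b`! by rewrite -(bin_fact ledb) dvdn_mulr.
by elim: b ltbp {ledb dvd_p} => [|b IHb] ltbp;
  rewrite ?fact0 ?Euclid_dvd1 // factS Euclid_dvdM // gtnNdvd //=; apply: IHb; lia.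
Qed.

(** * Counting the entries prime to p in a box *)

Lemma sum_nat_mul (M p : nat) (F : nat -> nat) :
  \sum_(0 <= m < M * p) F m =
  \sum_(0 <= a < M) \sum_(0 <= b < p) F (a * p + b).
Proof.
elim: M => [|M IHM]; first by rewrite mul0n !big_geq.
rewrite big_nat_recr //= -IHM (@big_cat_nat _ _ _ (M * p)) //=; last nia.
congr (_ + _); rewrite mulSn -{1}(addn0 (M * p)) addnC big_addn addnK.
by apply: eq_bigr => i _; rewrite addnC.
Qed.

(** The sum may run over the whole square: entries with n > m are 0, hence divisible by p and not
    counted. *)
Definition Pas_count (p M : nat) : nat :=
  \sum_(0 <= m < M) \sum_(0 <= n < M) ~~ (p %| 'C(m, n)).

(** Row b < p has exactly b + 1 entries prime to p, so the total is 1 + ... + p. *)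
Lemma Pas_count_digits (p : nat) : prime p -> Pas_count p p = 'C(p.+1, 2).
Proof.
move=> p_prime.
rewrite -bin2_sum big_nat_recl // add0n /Pas_count !big_nat.
apply: eq_bigr => b /andP[_ ltbp].
under eq_bigr => d _ do rewrite dvdn_bin_digit // -leqNgt.
rewrite (@big_cat_nat _ _ _ b.+1) //= [X in _ + X]big_nat [X in _ + X]big1 ?addn0; last first.
  by move=> d /andP[ltbd _]; rewrite leqNgt ltbd.
rewrite big_nat (eq_bigr (fun=> 1)); last by move=> d /andP[_]; rewrite ltnS => ->.
by rewrite -big_nat sum_nat_const_nat muln1 subn0.
Qed.

(** Self-similarity: by Lucas and Euclid's lemma, an entry is prime to p iff both its quotient entry
    and its digit entry are, so the sum factors. *)
Lemma Pas_count_mul (p M : nat) : prime p ->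
  Pas_count p (M * p) = Pas_count p M * Pas_count p p.
Proof.
move=> p_prime; rewrite /Pas_count sum_nat_mul big_distrl /=.
apply: eq_bigr => a _; rewrite exchange_big sum_nat_mul big_distrl /=.
apply: eq_bigr => c _; rewrite exchange_big_nat big_distrr /=.
rewrite !big_nat; apply: eq_bigr => b /andP[_ ltbp].
rewrite big_distrr /= !big_nat; apply: eq_bigr => d /andP[_ ltdp].
by rewrite /dvdn bin_lucas // -/(dvdn _ _) Euclid_dvdM // negb_or mulnb.
Qed.

Lemma Pas_count_expn (p k : nat) : prime p ->
  Pas_count p (p ^ k) = 'C(p.+1, 2) ^ k.
Proof.
move=> p_prime; elim: k => [|k IHk]; last first.
  by rewrite expnSr Pas_count_mul // IHk Pas_count_digits // expnSr.
by rewrite /Pas_count !big_nat1 bin0 dvdn1 gtn_eqF ?prime_gt1.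
Qed.

Local Open Scope ring_scope.

(** * Boxes as finite sets, and their comparison with [N_Pas] *)

Definition Pas_box (p M : nat) : {fset nat * nat} :=
  [fset mn in [seq mn <- [seq (m, n) | m <- iota 0 M, n <- iota 0 M]
              | ~~ (p %| 'C(mn.1, mn.2))%N]]%fset.

Lemma card_Pas_box (p M : nat) : #|` Pas_box p M|%fset = Pas_count p M.
Proof.
rewrite /Pas_box card_fseq undup_id; last first.
  by rewrite filter_uniq // allpairs_uniq ?iota_uniq // => -[a b] [c e].
rewrite size_filter -sum1_count big_mkcond big_allpairs_dep /Pas_count /index_iota.
rewrite subn0; apply: eq_bigr => m _; apply: eq_bigr => n _ /=.
by case: (_ %| _)%N.
Qed.

Lemma Pas_boxP (p M m n : nat) :
  reflect (Pas p (m, n) /\ (m < M)%N) ((m, n) \in Pas_box p M).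
Proof.
have neq0 : ('C(m, n) <> 0 %[mod p])%N <-> ~~ (p %| 'C(m, n))%N.
  by rewrite mod0n /dvdn; split => /eqP.
rewrite /Pas_box inE mem_filter /=.
apply: (iffP andP) => [[ndvd]|[[/= lenm /neq0 ndvd] ltmM]].
  case/allpairsP=> -[a b] /= [+ + [ma nb]]; rewrite -{}ma -{}nb !mem_iota /= !add0n => ltm _.
  split=> //; split=> /=; last exact/neq0.
  by rewrite leqNgt; apply: contra ndvd => ltmn; rewrite bin_small ?dvdn0.
split=> //; apply/allpairsP; exists (m, n); split=> //=; rewrite mem_iota //=.
by rewrite add0n (leq_ltn_trans lenm).
Qed.

Section Count.
Variables (R : realType) (p : nat) (P : {mpoly R[2]}) (u M : nat).
Hypothesis bounded : forall m n, Pas p (m, n) ->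
  eval2 P m%:R n%:R < u%:R -> (m < M)%N.

(** Needed for the lower bound as well: [fset_set] of an infinite set would be empty. *)
Let finite_N : finite_set [set mn : nat * nat |
  Pas p mn /\ eval2 P mn.1%:R mn.2%:R < u%:R]%classic.
Proof.
apply: (@finite_subfset _ (Pas_box p M)) => -[m n] /= [Pmn ltu].
by apply/Pas_boxP; split=> //; apply: bounded ltu.
Qed.

Lemma N_Pas_le : (N_Pas p P u <= Pas_count p M)%N.
Proof.
rewrite -card_Pas_box; apply: fsubset_leq_card; apply/fsubsetP => -[m n].
rewrite in_fset_set // inE /= => -[Pmn ltu].
by apply/Pas_boxP; split=> //; apply: bounded ltu.
Qed.

Lemma N_Pas_ge (M' : nat) :
  (forall m n, (n <= m)%N -> (m < M')%N -> eval2 P m%:R n%:R < u%:R) ->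
  (Pas_count p M' <= N_Pas p P u)%N.
Proof.
move=> small; rewrite -card_Pas_box; apply: fsubset_leq_card.
apply/fsubsetP => -[m n] /Pas_boxP[Pmn ltm]; rewrite in_fset_set // inE /=.
by split=> //; apply: small ltm; case: Pmn.
Qed.

End Count.

(** * Growth of P on the cone x >= y >= 0 *)

Section Growth.
Variable (R : realType).
Implicit Types (P : {mpoly R[2]}) (x y t : R).

Let monom (m : 'X_{1..2}) x y := x ^+ m ord0 * y ^+ m ord_max.

Let mdeg2 (m : 'X_{1..2}) : mdeg m = (m ord0 + m ord_max)%N.
Proof.
by rewrite mdegE big_ord_recl big_ord1; congr (_ + m _)%N; apply: val_inj.
Qed.

Let mevalX2 (m : 'X_{1..2}) x y :
  \prod_i tnth [tuple x; y] i ^+ m i = monom m x y.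
Proof.
rewrite big_ord_recl big_ord1 /monom; congr (_ * _ ^+ m _); exact: val_inj.
Qed.

Lemma eval2E P x y :
  eval2 P x y = \sum_(m <- msupp P) P@_m * monom m x y.
Proof. by rewrite /eval2 mevalE; apply: eq_bigr => m _; rewrite mevalX2. Qed.

Lemma eval2_homog_part (k : nat) P x y :
  eval2 (homog_part k P) x y =
  \sum_(m <- msupp P | mdeg m == k) P@_m * monom m x y.
Proof.
rewrite /eval2 /homog_part pihomogE raddf_sum /=.
by apply: eq_bigr => m _; rewrite mevalZ mevalX mevalX2.
Qed.

Lemma eval2_homog_partZ (k : nat) P t x y :
  eval2 (homog_part k P) (t * x) (t * y) = t ^+ k * eval2 (homog_part k P) x y.
Proof.
rewrite !eval2_homog_part big_distrr /=; apply: eq_bigr => m /eqP <-.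
by rewrite /monom mdeg2 exprD !exprMn; ring.
Qed.

(** A separate t >= x with t >= 1 lets one bound cover points with small x, the origin included;
    each monomial is at most t^k because both coordinates are at most t. *)
Lemma monom_sum_bound (s : seq 'X_{1..2}) (c : 'X_{1..2} -> R) (k : nat) :
  (forall m, m \in s -> (mdeg m <= k)%N) ->
  exists2 K : R, 0 < K & forall x y t, 0 <= y -> y <= x -> x <= t -> 1 <= t ->
    `|\sum_(m <- s) c m * monom m x y| < K * t ^+ k.
Proof.
(* The summand 1 keeps K positive and the bound strict even if all coefficients vanish. *)
move=> deg_le; exists (1 + \sum_(m <- s) `|c m|).
  by rewrite ltr_pwDl // sumr_ge0.
move=> x y t y0 yx xt t1.
have t0 : 0 < t by lra.
rewrite mulrDl mul1r ltr_pwDl ?exprn_gt0 // big_distrl /=.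
apply: (le_trans (ler_norm_sum _ _ _)); rewrite !big_seq; apply: ler_sum => m ms.
rewrite normrM ler_wpM2l // /monom ger0_norm ?mulr_ge0 ?exprn_ge0 //; try lra.
apply: (@le_trans _ _ (t ^+ mdeg m)); last by rewrite ler_weXn2l ?deg_le.
rewrite mdeg2 exprD ler_pM ?exprn_ge0 ?lerXn2r ?nnegrE //; lra.
Qed.

Lemma eval2_upper P : exists2 K : R, 0 < K &
  forall x y t, 0 <= y -> y <= x -> x <= t -> 1 <= t ->
    eval2 P x y < K * t ^+ total_degree P.
Proof.
have [m|K K0 bound] := @monom_sum_bound (msupp P) (fun m => P@_m) (total_degree P).
  by move=> /msize_mdeg_lt; rewrite /total_degree; case: mmeasure.
exists K => // x y t y0 yx xt t1; rewrite eval2E.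
exact: le_lt_trans (ler_norm _) (bound _ _ _ y0 yx xt t1).
Qed.

Lemma eval2_slope_continuous (k : nat) P :
  continuous (fun y : R => eval2 (homog_part k P) 1 y).
Proof.
rewrite (_ : (fun y => _) = horner
  (\sum_(m <- msupp P | mdeg m == k) P@_m *: 'X^(m ord_max))).
  by move=> y; apply: continuous_horner.
apply/funext => y; rewrite eval2_homog_part horner_sum.
by apply: eq_bigr => m _; rewrite /monom expr1n mul1r hornerZ hornerXn.
Qed.

Lemma eval2_lower P : T_elliptic P ->
  exists c x0 : R, [/\ 0 < c, 1 <= x0 &
    forall x y, 0 <= y -> y <= x -> x0 <= x ->
      c * x ^+ total_degree P <= eval2 P x y].
Proof.
rewrite /T_elliptic; set d := total_degree P => -[d0 elliptic].
pose f := fun y => eval2 (homog_part d P) 1 y.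
have [||s] := @EVT_min R f 0 1; [lra | |].
  by apply: continuous_subspaceT => y; apply: eval2_slope_continuous.
rewrite in_itv /= => /andP[s0 s1] f_min.
have fs0 : 0 < f s by apply: elliptic => // -[]; lra.
have [m|K K0 bound] := @monom_sum_bound [seq m <- msupp P | mdeg m != d]
    (fun m => P@_m) d.-1.
  rewrite mem_filter => /andP[neq /msize_mdeg_lt].
  by move: neq; rewrite /d /total_degree; lia.
(* Half of the minimum [f s] is given up to absorb the lower-order terms: x >= 2K / [f s] gives K
   x^(d-1) <= ([f s] / 2) x^d. The added 1 ensures x >= 1. *)
clearbody d; exists (f s / 2), (1 + 2 * K / f s); split.
- lra.
- by rewrite ler_wpDr // divr_ge0 //; lra.
move=> x y y0 yx x0x.
have Kfs : 0 < K / f s by rewrite divr_gt0.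
have x1 : 1 <= x by lra.
rewrite eval2E (bigID (fun m => mdeg m == d)) /= -eval2_homog_part.
have -> : eval2 (homog_part d P) x y = x ^+ d * f (y / x).
  by rewrite /f -eval2_homog_partZ mulr1 mulrCA divff ?mulr1 //; lra.
have fmin : f s <= f (y / x).
  apply: f_min; rewrite in_itv /= divr_ge0 //=; last lra.
  by rewrite ler_pdivrMr ?mul1r //; lra.
have := bound x y x y0 yx (lexx _) x1; rewrite big_filter ltr_norml => /andP[low _].
have x_gt0 : 0 < x by lra.
have xd0 : 0 < x ^+ d.-1 by rewrite exprn_gt0.
have xdE : x ^+ d = x * x ^+ d.-1 by rewrite -exprS prednK.
apply: (@le_trans _ _ (x ^+ d * f s - K * x ^+ d.-1)); last first.
  apply: lerD; last by lra.
  by rewrite ler_wpM2l // exprn_ge0 //; lra.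
rewrite xdE; set z := x ^+ d.-1 in xd0 *.
have : 2 * K <= x * f s.
  by rewrite -ler_pdivrMr //; lra.
nra.
Qed.

End Growth.

(** * Powers of p as scales, with p^theta = q *)

Section Scale.
Variables (R : realType) (p : nat).
Hypothesis p_prime : prime p.
Let q : R := 'C(p.+1, 2)%:R.

Lemma powR_theta : p%:R `^ theta R p = q.
Proof.
have p1 := prime_gt1 p_prime.
have qE : p%:R * (p%:R + 1) / 2 = q.
  apply: (canLR (mulfK _)); first by rewrite pnatr_eq0.
  by rewrite natr1 -!natrM [in RHS]mulnC -mul_bin_diag bin1 mulnC.
have q0 : 0 < q by rewrite ltr0n bin_gt0 ltnS prime_gt0.
rewrite /theta qE /powR pnatr_eq0 eqn0Ngt prime_gt0 //=.
rewrite divfK ?lnK ?posrE //.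
by rewrite gt_eqF // ln_gt0 // ltr1n.
Qed.

Lemma q_ge1 : 1 <= q.
Proof. by rewrite ler1n bin_gt0 ltnS prime_gt0. Qed.

Lemma theta_ge0 : 0 <= theta R p.
Proof.
have p1 : (1 : R) < p%:R by rewrite ltr1n prime_gt1.
by rewrite divr_ge0 ?ln_ge0 //; nra.
Qed.

Lemma powR_theta_expn (k d : nat) : (0 < d)%N ->
  ((p ^ k)%:R ^+ d) `^ (theta R p / d%:R) = q ^+ k.
Proof.
move=> d0; rewrite -powR_mulrn // -powRrM mulrCA divff ?pnatr_eq0 -?lt0n // mulr1.
rewrite natrX -powR_mulrn // powRAC powR_theta powR_mulrn //.
Qed.

(** Take the least k satisfying the strict upper bound; minimality gives the lower one, or 1 <= v
    does when k = 0. Raising both to the power theta/d turns box sides into box counts. *)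
Lemma p_adic_scale (v : R) (d : nat) : (0 < d)%N -> 1 <= v ->
  exists k : nat, [/\ (p ^ k)%:R ^+ d <= v, v < (p ^ k.+1)%:R ^+ d,
    q ^+ k <= v `^ (theta R p / d%:R) & v `^ (theta R p / d%:R) <= q ^+ k.+1].
Proof.
move=> d0 v1.
have ex_k : exists k, v < (p ^ k.+1)%:R ^+ d.
  exists (Num.Def.archi_bound v); apply: lt_le_trans (archi_boundP _) _; first lra.
  rewrite -natrX ler_nat (leq_trans (ltnW (ltn_expl _ (prime_gt1 p_prime)))) //.
  by rewrite -expnM leq_exp2l ?prime_gt1 //; nia.
have low_k : (p ^ ex_minn ex_k)%:R ^+ d <= v.
  case: ex_minnP => -[|k] ltv min_k; first by rewrite expn0 expr1n.
  by rewrite leNgt; apply/negP => /min_k; rewrite ltnn.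
have high_k : v < (p ^ (ex_minn ex_k).+1)%:R ^+ d by case: ex_minnP.
have e_ge0 : 0 <= theta R p / d%:R by rewrite divr_ge0 // theta_ge0.
have v_ge0 : 0 <= v by lra.
exists (ex_minn ex_k); move: (ex_minn ex_k) low_k high_k => k low_k high_k.
split=> //; rewrite -(@powR_theta_expn _ d) //.
  by apply: (ge0_ler_powR e_ge0); rewrite ?nnegrE ?exprn_ge0.
by apply: (ge0_ler_powR e_ge0); rewrite ?nnegrE ?exprn_ge0 // ltW.
Qed.

End Scale.

Theorem theorem1p3 (R : realType) (p : nat) (p_prime : prime p)
    (P : {mpoly R[2]}) (d : nat) (d_ge1 : (1 <= d)%N)
    (degP : total_degree P = d) (ellP : T_elliptic P)
    (P_ge0 : forall x y : R, 0 <= y -> y <= x -> 0 <= eval2 P x y) :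
  asymp (fun u : nat => (N_Pas p P u)%:R : R)
        (fun u : nat => u%:R `^ (theta R p / d%:R)).
Proof.
have [K K0 upper] := eval2_upper R P.
have [c [x0 [c0 x01 lower]]] := eval2_lower R P ellP.
rewrite {}degP in upper lower.
set e := theta R p / d%:R; pose q : R := 'C(p.+1, 2)%:R.
have q0 : 0 < q by rewrite (lt_le_trans ltr01) // q_ge1.
(* From N <= q^(l+1) <= q (u/c)^e and u^e = K^e (u/K)^e <= K^e q^(k+1) <= q K^e N; each factor q is
   the loss from rounding to a power of p. *)
exists (q * c^-1 `^ e), (q * K `^ e); split.
- by rewrite mulr_gt0 ?powR_gt0 ?invr_gt0.
- by rewrite mulr_gt0 ?powR_gt0.
near=> u.
have Ku : K <= u%:R by near: u; apply: nbhs_infty_ger.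
(* This handles the points with m < x0, where [lower] says nothing. *)
have x0u : c * x0 ^+ d <= u%:R by near: u; apply: nbhs_infty_ger.
have cu : c <= u%:R by rewrite (le_trans _ x0u) // ler_peMr ?exprn_ege1 // ltW.
rewrite !ger0_norm ?powR_ge0 //.
(* The outer box has side p^(l+1), above (u/c)^(1/d); the inner one has side p^k, at most
   (u/K)^(1/d). *)
have [|l [_ ltl lel _]] := p_adic_scale R p p_prime (u%:R / c) d d_ge1.
  by rewrite ler_pdivlMr ?mul1r.
have [|k [lek _ _ gek]] := p_adic_scale R p p_prime (u%:R / K) d d_ge1.
  by rewrite ler_pdivlMr ?mul1r.
have bounded m n : Pas p (m, n) -> eval2 P m%:R n%:R < u%:R -> (m < p ^ l.+1)%N.
  move=> [/= lenm _] ltu; rewrite ltnNge; apply/negP => lepm.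
  have ltum : u%:R < c * m%:R ^+ d.
    rewrite mulrC -ltr_pdivrMr //; apply: (lt_le_trans ltl).
    by rewrite lerXn2r ?nnegrE ?ler_nat.
  have [x0m|mx0] := leP x0 m%:R.
    have := lower m%:R n%:R; rewrite ler0n ler_nat => /(_ isT lenm x0m); lra.
  have : c * m%:R ^+ d <= c * x0 ^+ d.
    rewrite ler_wpM2l ?lerXn2r ?nnegrE //; lra.
  lra.
split.
  apply: (@le_trans _ _ (q ^+ l.+1)).
    by rewrite -natrX ler_nat -Pas_count_expn // N_Pas_le.
  rewrite exprS -mulrA ler_pM2l // (le_trans lel) //.
  by rewrite powRM ?invr_ge0 ?(ltW c0) // mulrC.
have leN : q ^+ k <= (N_Pas p P u)%:R.
  rewrite -natrX ler_nat -Pas_count_expn //.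
  apply: (N_Pas_ge _ _ _ _ _ bounded) => m n lenm ltm.
  rewrite ler_pdivlMr // mulrC in lek; apply: lt_le_trans lek.
  (* Taking t = p^k treats all points of the inner box at once. *)
  apply: upper; rewrite ?ler_nat ?ler0n ?ler1n ?expn_gt0 ?prime_gt0 //.
  exact: ltnW.
rewrite -[u%:R](divfK (lt0r_neq0 K0)) powRM ?divr_ge0 ?(ltW K0) //.
rewrite mulrC [q * _]mulrC -mulrA ler_wpM2l ?powR_ge0 // (le_trans gek) //.
by rewrite exprS ler_pM2l.
Unshelve. all: by end_near.
Qed.
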